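(* Let $n\ge 2$ and let $F:\mathbb{R}^n\to\mathbb{R}$ be Schur-convex and positively homogeneous of degree one, i.e. $F(t\boldsymbol{x})=tF(\boldsymbol{x})$ for all $t\ge 0$. For a simple graph $H$ of order $n$ put $\varphi(H):=F(\boldsymbol{\lambda}(H))$, and suppose that $\varphi(H)>0$ for every simple graph $H$ of order $n$ with at least one edge. Let $G$ be a simple graph of order $n$ with adjacency eigenvalues $\lambda_1\ge\cdots\ge\lambda_n$. Then, for all integers $r,s>0$ with $r+s=n$, $$\frac{\beta}{n-1}\le\frac{\varphi(G)}{(n-1)\varphi(M_n)}\le\frac{\lambda_1}{n-1}\le\frac{\varphi(G)}{\varphi(K_n)}\le|\lambda_n|\le\frac{\sqrt{rs}\,\varphi(G)}{\varphi(K_{r,s})}\le\frac{\|G\|_\ast}{2},$$ where $$\beta:=\begin{cases}\dfrac{2}{n}\displaystyle\sum_{j=1}^{n/2}\lambda_j & \text{if } n \text{ is even},\\[2mm] \dfrac{2}{n-1}\displaystyle\sum_{j=1}^{(n-1)/2}\lambda_j+\dfrac{2}{n-1}\min\bigl\{0,\lambda_{(n+1)/2}\bigr\} & \text{if } n \text{ is odd}.\end{cases}$$ In particular, if $G$ is bipartite, then $$\frac{\|G\|_\ast}{2\lfloor n/2\rfloor}\le\frac{\varphi(G)}{\varphi(M_n)}\le\lambda_1\le\frac{\sqrt{rs}\,\varphi(G)}{\varphi(K_{r,s})}\le\frac{\|G\|_\ast}{2}.$$ Moreover, in the first chain (the one for general $G$), the first and second inequalities hold with equality for $G=M_n$, the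 third and fourth hold with equality for $G=K_n$, and the last two hold with equality for $G=K_{r,s}$.
   Context: The eigenvalues of a graph are those of its adjacency matrix; $\boldsymbol{\lambda}(H)$ is the vector of eigenvalues of $H$ in decreasing order. The energy of $G$ is $\|G\|_\ast=|\lambda_1|+\cdots+|\lambda_n|$. $K_n$ is the complete graph on $n$ vertices, $K_{r,s}$ the complete bipartite graph with parts of sizes $r,s$, and $M_n$ the matching graph on $n$ vertices: a perfect matching if $n$ is even, and a perfect matching on $n-1$ vertices together with one isolated vertex if $n$ is odd. For $\boldsymbol{x},\boldsymbol{y}\in\mathbb{R}^n$, $\boldsymbol{x}\prec\boldsymbol{y}$ means $\sum_{j=1}^k x_j^{\downarrow}\le\sum_{j=1}^k y_j^{\downarrow}$ for $k=1,\dots,n$, with equality for $k=n$, where $\boldsymbol{x}^{\downarrow}$ is the decreasing rearrangement of $\boldsymbol{x}$. A function $F:\mathbb{R}^n\to\mathbb{R}$ is Schur-convex if $F(\boldsymbol{x})\le F(\boldsymbol{y})$ whenever $\boldsymbol{x}\prec\boldsymbol{y}$. *)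

(* Defs.v *)
From mathcomp Require Import all_boot all_order all_algebra.
From mathcomp Require Import polyrcf complex.
From mathcomp Require Import reals.

Set Implicit Arguments.
Unset Strict Implicit.
Unset Printing Implicit Defensive.
Import Order.TTheory GRing.Theory Num.Theory.

Local Open Scope ring_scope.

Record sgraph (n : nat) := SGraph {
  edge :> rel 'I_n;
  edge_sym : symmetric edge;
  edge_irr : irreflexive edge }.

Definition has_edge n (G : sgraph n) : Prop := exists i j, G i j.

Definition bipartite n (G : sgraph n) : Prop :=
  exists A : {set 'I_n}, forall i j, G i j -> (i \in A) != (j \in A).

Fact complete_sym n : symmetric (fun i j : 'I_n => i != j).
Proof. by move=> i j; rewrite eq_sym. Qed.
Fact complete_irr n : irreflexive (fun i j : 'I_n => i != j).
Proof. by move=> i; rewrite eqxx. Qed.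
Definition complete n : sgraph n := SGraph (@complete_sym n) (@complete_irr n).

(* [complete_bipartite n r] has parts {i | i < r} and {i | r <= i < n}; it is
   K_{r,s} when r + s = n. *)
Fact complete_bipartite_sym n r :
  symmetric (fun i j : 'I_n => (i < r)%N != (j < r)%N).
Proof. by move=> i j; rewrite eq_sym. Qed.
Fact complete_bipartite_irr n r :
  irreflexive (fun i j : 'I_n => (i < r)%N != (j < r)%N).
Proof. by move=> i; rewrite eqxx. Qed.
Definition complete_bipartite n r : sgraph n :=
  SGraph (@complete_bipartite_sym n r) (@complete_bipartite_irr n r).

(* The edges are {0,1}, {2,3}, ...; for odd n the last vertex is isolated. *)
Fact matching_sym n :
  symmetric (fun i j : 'I_n => (i != j) && (i./2 == j./2)).
Proof. by move=> i j; rewrite eq_sym [X in _ && X]eq_sym. Qed.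
Fact matching_irr n :
  irreflexive (fun i j : 'I_n => (i != j) && (i./2 == j./2)).
Proof. by move=> i; rewrite eqxx. Qed.
Definition matching n : sgraph n := SGraph (@matching_sym n) (@matching_irr n).

Section Spectra.
Variable R : realType.

Definition adjacency n (G : sgraph n) : 'M[R]_n :=
  \matrix_(i, j) (G i j)%:R.

(* The roots of the characteristic polynomial, with their multiplicities, in
   decreasing order; [size_eigenvalues] shows that a graph of order n has exactly
   n of them. *)
Definition eigenvalues n (A : 'M[R]_n) : seq R :=
  sort >=%R (flatten [seq nseq (mup x (char_poly A)) x
                     | x <- rootsR (char_poly A)]).

(* One-based: [eigval G j] is lambda_j for 1 <= j <= n. *)
Definition eigval n (G : sgraph n) (j : nat) : R :=
  nth 0 (eigenvalues (adjacency G)) j.-1.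

Definition spectrum n (G : sgraph n) : 'rV[R]_n := \row_j eigval G j.+1.

Definition energy n (G : sgraph n) : R := \sum_(1 <= j < n.+1) `|eigval G j|.

Definition beta n (G : sgraph n) : R :=
  if odd n then
    2 / n.-1%:R * (\sum_(1 <= j < (n.-1)./2.+1) eigval G j)
    + 2 / n.-1%:R * Num.min 0 (eigval G (n.+1)./2)
  else 2 / n%:R * (\sum_(1 <= j < n./2.+1) eigval G j).

Definition rearrangement n (x : 'rV[R]_n) : 'rV[R]_n :=
  \row_j nth 0 (sort >=%R [seq x 0 i | i <- enum 'I_n]) j.

Definition majorized n (x y : 'rV[R]_n) : Prop :=
  (forall k, (1 <= k <= n)%N ->
     \sum_(j < n | (j < k)%N) rearrangement x 0 j
       <= \sum_(j < n | (j < k)%N) rearrangement y 0 j)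
  /\ \sum_(j < n) rearrangement x 0 j = \sum_(j < n) rearrangement y 0 j.

Definition schur_convex n (F : 'rV[R]_n -> R) : Prop :=
  forall x y, majorized x y -> F x <= F y.

Definition positively_homogeneous n (F : 'rV[R]_n -> R) : Prop :=
  forall (t : R) (x : 'rV[R]_n), 0 <= t -> F (t *: x) = t * F x.

End Spectra.

Arguments eigval {R n} G j.
Arguments spectrum {R n} G.
Arguments energy {R n} G.
Arguments beta {R n} G.

Section SpectraFacts.
Local Open Scope complex_scope.
Variable R : realType.

Lemma symmetric_char_poly_split n (A : 'M[R]_n) : A^T = A ->
  {s : seq R | char_poly A = \prod_(x <- s) ('X - x%:P)}.
Proof.
move=> symA; pose B := map_mx (real_complex R) A.
have hermB : B \is hermsymmx.
  rewrite is_hermitianmxE expr0 scale1r; apply/eqP.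
  by apply/matrixP=> i j; rewrite !mxE -{1}symA mxE; apply/esym/conjc_real.
have normB := hermitian_normalmx hermB.
have eqB : B = invmx (spectralmx B) *m diag_mx (spectral_diag B) *m spectralmx B.
  exact/orthomx_spectralP.
have realB := hermitian_spectral_diag_real hermB.
exists [seq complex.Re (spectral_diag B 0 i) | i <- enum 'I_n].
apply: (map_poly_inj (real_complex R)).
rewrite map_char_poly -/B rmorph_prod big_map big_enum /=.
have -> : char_poly B = char_poly (diag_mx (spectral_diag B)).
  have uS := spectral_unit B.
  rewrite [in LHS]eqB /char_poly /char_poly_mx !map_mxM /=.
  set T := map_mx _ (invmx _); set S := map_mx _ (spectralmx B).
  set D := map_mx _ (diag_mx _).
  have TS : T *m S = 1%:M by rewrite -map_mxM mulVmx // map_mx1.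
  have -> : 'X%:M - T *m D *m S = T *m ('X%:M - D) *m S.
    by rewrite mulmxBr mulmxBl scalar_mxC -[_ *m T *m S]mulmxA TS mulmx1.
  rewrite !det_mulmx mulrAC -det_mulmx TS det1 mul1r //.
rewrite char_poly_trig ?diag_mx_is_trig //; apply: eq_bigr => i _.
rewrite rmorphB /= map_polyX map_polyC /= !mxE eqxx mulr1n; congr (_ - _%:P).
by apply/esym/RRe_real; move/mxOverP: realB; apply.
Qed.

Lemma char_poly_eigenvalues n (A : 'M[R]_n) : A^T = A ->
  char_poly A = \prod_(x <- eigenvalues A) ('X - x%:P).
Proof.
move=> /symmetric_char_poly_split[s eqs].
rewrite {1}eqs; apply: perm_big; rewrite perm_sym perm_sort.
apply/allP => /= x _; apply/eqP; rewrite count_flatten -map_comp.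
have pN0 : char_poly A != 0 by rewrite monic_neq0 ?char_poly_monic.
have cE y : count_mem x (nseq (mup y (char_poly A)) y)
    = ((y == x) * mup x (char_poly A))%N.
  by rewrite count_nseq /=; case: eqP => [->|].
rewrite (eq_map (f := _ \o _) (g := fun y => (y == x) * mup x (char_poly A))%N) //.
rewrite sumnE big_map -big_distrl /= -big_mkcond /= sum1_count.
rewrite count_uniq_mem ?uniq_roots //.
have <- /= := roots_on_rootsR pN0 x; rewrite eqs mu_prod_XsubC.
by rewrite root_prod_XsubC; case: (boolP (x \in s)) => [_|/count_memPn->];
  rewrite ?mul1n ?muln0.
Qed.

Lemma adjacency_sym n (G : sgraph n) : (adjacency R G)^T = adjacency R G.
Proof. by apply/matrixP=> i j; rewrite !mxE edge_sym. Qed.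

Lemma size_eigenvalues n (G : sgraph n) :
  size (eigenvalues (adjacency R G)) = n.
Proof.
have /(congr1 (size \o polyseq)) /= := char_poly_eigenvalues (adjacency_sym G).
by rewrite size_char_poly size_prod_XsubC => -[].
Qed.

Lemma eigenvalues_sorted n (A : 'M[R]_n) : sorted >=%R (eigenvalues A).
Proof. by apply: sort_sorted => x y; apply: le_total. Qed.

End SpectraFacts.

(* Main.v *)
Require Import Defs.
From mathcomp Require Import all_boot all_order all_algebra.
From mathcomp Require Import complex reals zify ring lra.

(** Write [S k] for the sum of the [k] largest eigenvalues of [G]. The total
    [S n] is the trace of the adjacency matrix, which is 0 for every graph, and
    [S] is a concave function of [k]. By [schur_convex_spectra_le], Schur
    convexity and homogeneity of [F] reduce every inequality between a multiple
    of [phi G] and a multiple of [phi H] to the same inequality between the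
    sequences [S] of [G] and of [H]. For the three comparison graphs these
    sequences are explicit, for [0 < k < n]:
    - [minn k (n - k)] for the matching, a symmetric tent;
    - [n - k] for the complete graph, a decreasing line;
    - the constant [sqrt (r * s)] for the complete bipartite graph.

    A lower bound of [phi G] thus asks for the largest multiple of such a profile
    lying below [S], and concavity says that a few values decide: the middle
    ones for the tent, which is what [beta] records; the first one, [lambda_1],
    for the line; the first and the one before the last, [lambda_1] and
    [- lambda_n], for the constant. An upper bound asks for a multiple lying
    above [S]: [S k] is at most [k * lambda_1] and at most
    [(n - k) * - lambda_n], and its maximum is at most half the energy because
    the positive eigenvalues and the negative ones have opposite sums. Both the
    tent upper bound and the constant lower bound use the Perron-Frobenius
    inequality [|lambda_n| <= lambda_1] ([eigval_last_ge]), obtained here from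
    the nonnegativity of the odd moments [tr (A ^+ (2k+1))]. If [G] is bipartite
    its spectrum is symmetric, so [|lambda_n| = lambda_1], and half the energy is
    the value of [S] at both middle indices.

    The explicit spectra come from trace identities: the adjacency matrix
    satisfies a polynomial equation of degree 2 (complete graph) or 3 (the other
    two), so the eigenvalues take at most three values, and the trace, together
    with the number of edges in the cubic case, gives the multiplicities. *)

Set Implicit Arguments.
Unset Strict Implicit.
Unset Printing Implicit Defensive.
Import Order.TTheory GRing.Theory Num.Theory.

Local Open Scope ring_scope.

(** * Moments of the spectrum of a symmetric matrix *)

Lemma char_poly_conj (K : fieldType) n (P D : 'M[K]_n) :
  P \in unitmx -> char_poly (invmx P *m D *m P) = char_poly D.
Proof.
move=> uP; rewrite /char_poly /char_poly_mx !map_mxM /=.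
set T := map_mx _ (invmx _); set S := map_mx _ P; set Dp := map_mx _ D.
have TS : T *m S = 1%:M by rewrite -map_mxM mulVmx // map_mx1.
have -> : 'X%:M - T *m Dp *m S = T *m ('X%:M - Dp) *m S.
  by rewrite mulmxBr mulmxBl scalar_mxC -[_ *m T *m S]mulmxA TS mulmx1.
by rewrite !det_mulmx mulrAC -det_mulmx TS det1 mul1r.
Qed.

(** Over the complex numbers [A] is conjugate to a diagonal matrix, whose
    entries are the eigenvalues because the characteristic polynomials agree;
    both sides are then the trace of the [k]-th power of that matrix. *)
Lemma mxtrace_exp_symmetric (R : realType) n (A : 'M[R]_n) k :
  A^T = A -> \tr (A ^+ k) = \sum_(x <- eigenvalues A) x ^+ k.
Proof.
move=> symA; pose f := real_complex R; pose B := map_mx f A.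
have /orthomx_spectralP : B \is normalmx.
  apply/hermitian_normalmx; rewrite is_hermitianmxE expr0 scale1r; apply/eqP.
  by apply/matrixP=> i j; rewrite !mxE -{1}symA mxE; apply/esym/conjc_real.
set P := spectralmx B; set d := spectral_diag B => eqB.
have uP : P \in unitmx := spectral_unit B.
have permd : perm_eq [seq f x | x <- eigenvalues A] [seq d 0 i | i <- enum 'I_n].
  apply: prod_XsubC_eq; rewrite big_map [RHS]big_map big_enum /=.
  under eq_bigr => x _ do
    rewrite -(map_polyX f) -(map_polyC f) -[map_poly f 'X - _]rmorphB.
  rewrite -rmorph_prod -char_poly_eigenvalues //= map_char_poly -/B eqB.
  rewrite char_poly_conj // char_poly_trig ?diag_mx_is_trig //.
  by apply: eq_bigr => i _; rewrite mxE eqxx mulr1n.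
have powB : B ^+ k = invmx P *m diag_mx (\row_i d 0 i ^+ k) *m P.
  elim: k => [|k IHk].
    rewrite expr0 (_ : diag_mx _ = 1%:M) ?mulmx1 ?mulVmx //.
    by apply/matrixP => i j; rewrite !mxE expr0.
  rewrite exprS IHk {1}eqB -!mulmxE !mulmxA mulmxK // -[_ *m _ *m diag_mx _]mulmxA.
  rewrite mulmx_diag; congr (_ *m diag_mx _ *m _).
  by apply/rowP => i; rewrite !mxE exprS.
apply: (fmorph_inj f).
rewrite -trace_map_mx rmorph_sum /=.
have -> : map_mx f (A ^+ k) = B ^+ k.
  elim: (k) => [|l IHl]; first by rewrite !expr0 map_mx1.
  by rewrite !exprS -!mulmxE map_mxM IHl.
rewrite powB mxtrace_mulC mulmxA mulmxV // mul1mx mxtrace_diag.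
transitivity (\sum_(z <- [seq f x | x <- eigenvalues A]) z ^+ k); last first.
  by rewrite big_map; apply: eq_bigr => x _; rewrite -rmorphXn.
rewrite (perm_big _ permd) big_map big_enum /=.
by apply: eq_bigr => i _; rewrite mxE.
Qed.

(** If [b] exceeded [a], the term [- b ^+ (2k+1)] would outgrow the other terms,
    each of which is at most [a ^+ (2k+1)]: the power being odd, negative entries
    contribute at most 0. *)
Lemma odd_moment_bound (R : realType) (s : seq R) (a b : R) :
  0 <= a -> {in s, forall x, x <= a} -> - b \in s ->
  (forall k, 0 <= \sum_(x <- s) x ^+ k.*2.+1) -> b <= a.
Proof.
move=> a0 sa bs mom; rewrite leNgt; apply/negP => ltab.
have b0 : 0 < b by apply: le_lt_trans ltab.
have powle k : b ^+ k.*2.+1 <= (size s)%:R * a ^+ k.*2.+1.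
  have := mom k; rewrite (big_rem _ bs) /= exprNn -signr_odd /= odd_double expr1.
  rewrite mulN1r addrC subr_ge0 => /le_trans; apply.
  apply: (@le_trans _ _ (\sum_(x <- rem (- b) s) a ^+ k.*2.+1)).
    rewrite big_seq [leRHS]big_seq; apply: ler_sum => x /mem_rem xs.
    have [x0|x0] := leP 0 x; first by apply: lerXn2r; rewrite ?nnegrE //; apply: sa.
    apply: (@le_trans _ _ 0); last exact: exprn_ge0.
    by rewrite exprn_odd_le0 //= ?odd_double ?ltW.
  rewrite big_const_seq iter_addr_0 count_predT -[leLHS]mulr_natl ler_wpM2r ?exprn_ge0 //.
  by rewrite ler_nat size_rem // leq_pred.
have a1 : 0 < a.
  rewrite lt_neqAle a0 andbT; apply/eqP => a0'.
  by have := powle 0; rewrite -a0' expr0n /= mulr0 expr1 leNgt b0.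
(* By Bernoulli's inequality the powers of b / a, if it exceeds 1, are
   unbounded, while the previous bound keeps the odd ones below the size. *)
pose h := b / a - 1.
have h0 : 0 < h by rewrite subr_gt0 ltr_pdivlMr ?mul1r.
have bern k : 1 + k%:R * h <= (1 + h) ^+ k.
  elim: k => [|k IHk]; first by rewrite mul0r addr0 expr0.
  rewrite exprS; apply: le_trans (ler_wpM2l _ IHk); last by lra.
  by rewrite -natr1; have := ler0n R k; nra.
have hk k : 1 + k.*2.+1%:R * h <= (size s)%:R.
  apply: le_trans (bern _) _; rewrite addrC subrK expr_div_n.
  by rewrite ler_pdivrMr ?exprn_gt0.
have := hk (Num.bound ((size s)%:R / h)).
have : 0 <= (size s)%:R / h by rewrite divr_ge0 ?ler0n ?ltW.
move=> /archi_boundP; rewrite ltr_pdivrMr //; set N := Num.bound _ => ltN.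
have : (N%:R : R) <= N.*2.+1%:R by rewrite ler_nat; lia.
by nra.
Qed.

(** * Eigenvalues from matrix identities *)

Lemma eigenvalues_root (R : realType) n (A : 'M[R]_n) x :
  A^T = A -> x \in eigenvalues A -> eigenvalue A x.
Proof.
by move=> symA xA; rewrite eigenvalue_root_char char_poly_eigenvalues //
  root_prod_XsubC.
Qed.

Lemma eigenvalue_cubic (K : fieldType) n (A : 'M[K]_n) c x :
  A *m A *m A = c *: A -> eigenvalue A x -> x ^+ 3 = c * x.
Proof.
move=> A3 /eigenvalueP[v vA vN0]; apply/eqP.
have := congr1 (mulmx v) A3; rewrite -scalemxAr !mulmxA.
do 3![rewrite ?vA -?scalemxAl]; rewrite ?vA !scalerA => /eqP.
rewrite -subr_eq0 -scalerBl scaler_eq0 (negPf vN0) orbF subr_eq0.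
by move=> /eqP<-; apply/eqP; ring.
Qed.

Lemma eigenvalue_quadratic (K : fieldType) n (A : 'M[K]_n) b c x :
  A *m A = b *: A + c%:M -> eigenvalue A x -> x ^+ 2 = b * x + c.
Proof.
move=> A2 /eigenvalueP[v vA vN0]; apply/eqP.
have := congr1 (mulmx v) A2; rewrite mulmxDr mul_mx_scalar -scalemxAr !mulmxA.
do 2![rewrite ?vA -?scalemxAl]; rewrite ?vA !scalerA -scalerDl => /eqP.
by rewrite -subr_eq0 -scalerBl scaler_eq0 (negPf vN0) orbF subr_eq0.
Qed.

(** Each entry of ['X + A] is minus the value at [- 'X] of that of ['X - A]. *)
Lemma char_polyN (K : fieldType) n (A : 'M[K]_n) :
  char_poly (- A) = (-1) ^+ n * (char_poly A \Po (- 'X)).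
Proof.
rewrite /char_poly; have -> : char_poly_mx (- A) =
    (-1) *: map_mx (comp_poly (- 'X)) (char_poly_mx A).
  apply/matrixP => i j; rewrite !mxE polyCN opprK raddfB /= raddfMn /= comp_polyX.
  by rewrite comp_polyC mulN1r opprB mulNrn opprK addrC.
by rewrite detZ det_map_mx.
Qed.

(** Conjugating by the signs of the two colour classes negates the adjacency
    matrix of a bipartite graph. *)
Lemma bipartite_eigenvalues (R : realType) n (G : sgraph n) (A := adjacency R G) :
  bipartite G -> perm_eq [seq - x | x <- eigenvalues A] (eigenvalues A).
Proof.
move=> [C CG]; apply: prod_XsubC_eq.
rewrite -char_poly_eigenvalues ?adjacency_sym // big_map.
pose e i : R := (-1) ^+ (i \in C); pose D := diag_mx (\row_i e i).
have ee i : e i * e i = 1 by rewrite -expr2 sqrr_sign.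
have DD : D *m D = 1%:M.
  by rewrite mulmx_diag; apply/matrixP => i j; rewrite !mxE ee.
have uD : D \in unitmx by case: (mulmx1_unit DD).
have iD : invmx D = D by rewrite -[LHS]mulmx1 -DD mulKmx.
have AD : A = invmx D *m (- A) *m D.
  rewrite iD mul_mx_diag mul_diag_mx; apply/matrixP => i j; rewrite !mxE.
  have [ij|_] := boolP (G i j); last by rewrite oppr0 mulr0 mul0r.
  move: (CG i j ij); rewrite /e; case: (i \in C); case: (j \in C) => //= _; ring.
rewrite [in RHS]AD char_poly_conj //.
rewrite char_polyN char_poly_eigenvalues ?adjacency_sym // rmorph_prod.
have -> : (-1) ^+ n = (-1) ^+ size (eigenvalues A) :> {poly R}.
  by rewrite size_eigenvalues.
elim: (eigenvalues A) => [|x s IHs]; first by rewrite !big_nil mulr1.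
rewrite !big_cons exprS mulrACA -IHs rmorphB /= comp_polyX comp_polyC polyCN.
by rewrite mulN1r opprB !opprK addrC.
Qed.

(** * Sorted sequences with few values *)

Lemma sorted_flatten_count (R : realDomainType) (s vs : seq R) :
  sorted >=%R s -> sorted >%R vs -> {subset s <= vs} ->
  s = flatten [seq nseq (count_mem v s) v | v <- vs].
Proof.
move=> sS vsS svs.
have ge_tr : transitive (>=%R : rel R).
  by move=> x y z; rewrite /= => ? /le_trans; apply.
apply: (@sorted_eq _ >=%R) => //.
- by move=> x y; rewrite /= andbC => /le_anti.
- move: vsS; rewrite (sorted_pairwise ge_tr) sorted_pairwise; last first.
    by move=> x y z; rewrite /= => ? /lt_trans; apply.
  elim: vs {svs} => //= v vs IHvs /andP[vvs /IHvs vsS].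
  rewrite pairwise_cat vsS andbT; apply/andP; split; last first.
    elim: (count_mem v s) => //= k ->; rewrite andbT.
    by apply/allP => x; rewrite mem_nseq => /andP[_ /eqP->] /=.
  apply/allrelP => x y; rewrite mem_nseq => /andP[_ /eqP->].
  move=> /flatten_mapP[z zvs]; rewrite mem_nseq => /andP[_ /eqP->].
  by rewrite /= ltW //; apply: (allP vvs).
have uvs : uniq vs.
  by move: vsS; apply: sorted_uniq => [x y z /= ? /lt_trans|x /=]; [apply|rewrite ltxx].
apply/allP => x _; apply/eqP; rewrite /= count_flatten -map_comp.
rewrite (eq_map (g := fun v => (v == x) * count_mem x s)%N); last first.
  by move=> v /=; rewrite count_nseq /=; case: eqP => [->|].
rewrite sumnE big_map -big_distrl /= -big_mkcond /= sum1_count.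
rewrite (count_uniq_mem x uvs); case: (boolP (x \in vs)) => [_|xvs].
  by rewrite mul1n.
by apply/count_memPn; apply: contra xvs; apply: svs.
Qed.

Lemma sum_nseq (V : nmodType) T (F : T -> V) k v : \sum_(x <- nseq k v) F x = F v *+ k.
Proof. by elim: k => [|k IHk] /=; rewrite ?big_nil // big_cons IHk mulrS. Qed.

(** The entries are [w], 0 and [- w]; the sum makes [w] and [- w] equally
    frequent, and the sum of squares counts them. *)
Lemma sorted_cubic_roots (R : realDomainType) (s : seq R) w m :
  0 < w -> sorted >=%R s -> {in s, forall x, x ^+ 3 = w ^+ 2 * x} ->
  \sum_(x <- s) x = 0 -> \sum_(x <- s) x ^+ 2 = w ^+ 2 *+ m.*2 ->
  s = nseq m w ++ nseq (size s - m.*2) 0 ++ nseq m (- w).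
Proof.
move=> w0 sS sw s1 s2.
have := @sorted_flatten_count R s [:: w; 0; - w] sS; rewrite /= cats0.
rewrite oppr_lt0 w0 => /(_ isT) es.
have {}es := es _; set a := count_mem w s in es; set z := count_mem 0 s in es.
set b := count_mem (- w) s in es.
have {}es : s = nseq a w ++ nseq z 0 ++ nseq b (- w).
  apply: es => x /sw xw; rewrite !inE.
  have /eqP : x * (x - w) * (x + w) = 0.
    by transitivity (x ^+ 3 - w ^+ 2 * x); [ring|rewrite xw subrr].
  by rewrite !mulf_eq0 subr_eq0 addr_eq0 => /orP[/orP[]|] ->; rewrite ?orbT.
move: s1 s2; rewrite es !big_cat /= !sum_nseq !size_cat !size_nseq.
rewrite expr0n /= !mul0rn !add0r sqrrN mulNrn => /eqP.
rewrite subr_eq0 => /eqP/mulrIn; rewrite gt_eqF // => /(_ isT) -> {a es}.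
rewrite -mulrnDr => /mulrIn; rewrite expf_eq0 /= gt_eqF // => /(_ isT) eb.
have <- : b = m by lia.
by congr (_ ++ (nseq _ _ ++ _)); lia.
Qed.

(** The quadratic has roots [size s - 1] and -1; a zero sum leaves room for
    only one occurrence of the former. *)
Lemma sorted_complete_roots (R : realDomainType) (s : seq R) :
  (1 < size s)%N -> sorted >=%R s ->
  {in s, forall x, x ^+ 2 = (size s - 2)%:R * x + (size s - 1)%:R} ->
  \sum_(x <- s) x = 0 ->
  s = (size s - 1)%:R :: nseq (size s - 1) (- 1).
Proof.
move=> n1 sS sw s1; set N := (size s - 1)%N in sw *.
have N0 : 0 < N%:R :> R by rewrite ltr0n /N; lia.
have eN : (size s - 2)%:R = N%:R - 1 :> R.
  by rewrite -[1]/(1%:R) -natrB; [congr _%:R; lia | lia].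
have := @sorted_flatten_count R s [:: N%:R; - 1] sS; rewrite /= cats0.
rewrite (lt_trans _ N0) ?ltrN10 // => /(_ isT) es.
have {}es := es _; set a := count_mem _ s in es; set b := count_mem _ s in es.
have {}es : s = nseq a N%:R ++ nseq b (- 1).
  apply: es => x /sw xw; rewrite !inE.
  have /eqP : (x - N%:R) * (x + 1) = 0.
    transitivity (x ^+ 2 - ((N%:R - 1) * x + N%:R)); first by ring.
    by rewrite xw eN subrr.
  by rewrite mulf_eq0 subr_eq0 addr_eq0.
have sz : (a + b = N.+1)%N.
  by have := congr1 size es; rewrite size_cat !size_nseq; rewrite /N; lia.
move: s1; rewrite es big_cat /= !sum_nseq mulNrn => /eqP.
rewrite subr_eq0 -mulrnA eqr_nat => /eqP eab.
have a1 : a = 1%N by nia.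
have -> : b = N by lia.
by rewrite a1.
Qed.

(** * Eigenvalues of a graph *)

Lemma sum_eigenvalues (R : realType) n (G : sgraph n) :
  \sum_(x <- eigenvalues (adjacency R G)) x = 0.
Proof.
transitivity (\tr (adjacency R G ^+ 1)).
  by rewrite mxtrace_exp_symmetric ?adjacency_sym.
by rewrite expr1 /mxtrace big1 // => i _; rewrite mxE edge_irr.
Qed.

Lemma sum_sqr_eigenvalues (R : realType) n (G : sgraph n) :
  \sum_(x <- eigenvalues (adjacency R G)) x ^+ 2 = \sum_i \sum_j (G i j)%:R.
Proof.
rewrite -mxtrace_exp_symmetric ?adjacency_sym // expr2 -mulmxE.
apply: eq_bigr => i _; rewrite mxE; apply: eq_bigr => j _.
by rewrite !mxE edge_sym -natrM mulnb andbb edge_sym.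
Qed.

Lemma sum_eigval (R : realType) n (G : sgraph n) (f : R -> R) :
  \sum_(j < n) f (eigval G j.+1) = \sum_(x <- eigenvalues (adjacency R G)) f x.
Proof.
rewrite (big_nth 0) size_eigenvalues big_mkord.
by apply: eq_bigr.
Qed.

Lemma eigval_nonincreasing (R : realType) n (G : sgraph n) i j :
  (i <= j < n)%N -> eigval G j.+1 <= eigval G i.+1 :> R.
Proof.
move=> /andP[ij jn]; rewrite /eigval /=.
apply: (sorted_leq_nth (leT := >=%R)) => //.
- by move=> x y z; rewrite /= => ? /le_trans; apply.
- by move=> x; exact: lexx.
- exact: eigenvalues_sorted.
- by rewrite inE size_eigenvalues (leq_ltn_trans ij).
- by rewrite inE size_eigenvalues.
Qed.

(** Closed walks are counted by nonnegative numbers, so all moments of the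
    spectrum are nonnegative; the odd ones force [|lambda_n| <= lambda_1]. *)
Lemma eigval_last_ge (R : realType) n (G : sgraph n) : (0 < n)%N ->
  - eigval G n <= eigval G 1 :> R.
Proof.
case: n G => // n G _; set A := adjacency R G.
have sE i : (i < n.+1)%N -> eigval G i.+1 \in eigenvalues A.
  by move=> i_n; apply: mem_nth; rewrite size_eigenvalues.
have le1 x : x \in eigenvalues A -> x <= eigval G 1.
  move=> xA; rewrite -(nth_index 0 xA).
  apply: (@eigval_nonincreasing _ _ G 0 (index x _)).
  by rewrite -[X in (_ < X)%N](size_eigenvalues R G) index_mem.
apply: (@odd_moment_bound _ (eigenvalues A)) => //.
- have : \sum_(x <- eigenvalues A) x <= \sum_(x <- eigenvalues A) eigval G 1.
    by rewrite big_seq [leRHS]big_seq; apply: ler_sum => x /le1.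
  rewrite sum_eigenvalues big_const_seq iter_addr_0 count_predT size_eigenvalues.
  by rewrite pmulrn_lge0.
- by rewrite opprK sE.
move=> k; rewrite -mxtrace_exp_symmetric ?adjacency_sym //.
have pos l i j : 0 <= (A ^+ l) i j.
  elim: l i j => [|l IHl] i j; first by rewrite expr0 mxE ler0n.
  rewrite exprS mxE; apply: sumr_ge0 => h _.
  by rewrite mulr_ge0 // mxE ler0n.
by apply: sumr_ge0.
Qed.

(** * Spectra of the matching, complete and complete bipartite graphs *)

Lemma sum_ord_ltn (R : pzSemiRingType) n m :
  \sum_(i < n) (i < m)%:R = (minn m n)%:R :> R.
Proof.
elim: n => [|n IHn]; first by rewrite big_ord0 minn0.
by rewrite big_ord_recr /= IHn -natrD; congr _%:R; lia.
Qed.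

(** Up to a factor, the common shape of the spectra of the complete bipartite
    graphs ([m = 1]) and of the matching ([m = n./2]): 1 and -1 with multiplicity
    [m], and 0 in between. *)
Definition level (R : pzRingType) n m j : R := (j < m)%:R - (n - m <= j)%:R.

(** The matching graph and the complete bipartite graphs both have adjacency
    matrices whose cube is proportional to them; the number of edges fixes the
    sum of the squared eigenvalues, which is the trace of [A ^+ 2]. *)
Lemma eigval_cubic (R : realType) n (G : sgraph n) (A := adjacency R G) (c : R) m :
  0 < c -> (m.*2 <= n)%N -> A *m A *m A = c *: A ->
  \sum_i \sum_j (G i j)%:R = c *+ m.*2 ->
  forall j, (j < n)%N -> eigval G j.+1 = Num.sqrt c * level R n m j.
Proof.
move=> c0 mn A3 A2 j jn; have w0 : 0 < Num.sqrt c by rewrite sqrtr_gt0.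
have wc : Num.sqrt c ^+ 2 = c by rewrite sqr_sqrtr ?ltW.
have := @sorted_cubic_roots _ (eigenvalues A) _ m w0 (eigenvalues_sorted _).
rewrite wc sum_sqr_eigenvalues sum_eigenvalues => /(_ _ (erefl _) A2).
have xA : {in eigenvalues A, forall x, x ^+ 3 = c * x}.
  move=> x /(eigenvalues_root (adjacency_sym R G)).
  exact: eigenvalue_cubic.
move=> /(_ xA); rewrite size_eigenvalues /eigval /= /A => ->.
rewrite !nth_cat !nth_nseq !size_nseq /level.
case: ltnP => jm.
  by rewrite leqNgt (_ : (j < _)%N) ?subr0 ?mulr1 //; lia.
case: ltnP => jm2.
  by rewrite leqNgt (_ : (j < _)%N) ?subr0 ?mulr0 //; lia.
rewrite (_ : (j - m - _ < m)%N) ?sub0r; last by lia.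
by rewrite (_ : (n - m <= j)%N) ?mulrN1 //; lia.
Qed.

(** The adjacency matrix is [J - 1] with [J] the all-one matrix, and
    [J ^+ 2 = n J]. *)
Lemma eigval_complete (R : realType) n : (1 < n)%N -> forall j, (j < n)%N ->
  eigval (complete n) j.+1 = if j == 0 then (n - 1)%:R else - 1 :> R.
Proof.
move=> n1 j jn; pose A := adjacency R (complete n).
have := @sorted_complete_roots _ (eigenvalues A).
rewrite size_eigenvalues sum_eigenvalues => /(_ n1 (eigenvalues_sorted _)).
move=> /(_ _ (erefl _)) es.
rewrite /eigval /= -/A es; first by case: j jn => //= j jn; rewrite nth_nseq ifT //; lia.
move=> x /(eigenvalues_root (adjacency_sym _ _)); apply: eigenvalue_quadratic.
have eA : A = const_mx 1 - 1%:M.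
  by apply/matrixP => i k; rewrite !mxE /=; case: eqP => _; rewrite ?subrr ?subr0.
have J2 : (const_mx 1 : 'M[R]_n) *m (const_mx 1 : 'M[R]_n) = n%:R *: const_mx 1.
  apply/matrixP => i k; rewrite !mxE mulr1.
  by under eq_bigr do rewrite !mxE mulr1; rewrite sumr_const card_ord.
rewrite -/A eA mulmxBl !mulmxBr J2 !mulmx1 mul1mx !natrB //; last exact: ltnW.
by apply/matrixP => i k; rewrite !mxE; case: eqP => _; rewrite ?mulr1n ?mulr0n; ring.
Qed.

(** [A ^+ 2] counts walks of length 2: both ends are in the same part, and the
    middle vertex is any vertex of the other part, so [A ^+ 3 = (r * s) A]. *)
Lemma eigval_complete_bipartite (R : realType) n r s :
  (0 < r)%N -> (0 < s)%N -> (r + s)%N = n -> forall j, (j < n)%N ->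
  eigval (complete_bipartite n r) j.+1 = Num.sqrt (r * s)%:R * level R n 1 j.
Proof.
move=> r0 s0 rsn; pose d (b : bool) : nat := if b then r else s.
have dd b : (d b * d (~~ b))%N = (r * s)%N by case: b => //=; rewrite mulnC.
have sumd b : \sum_(j < n) ((j < r)%N == b)%:R = (d b)%:R :> R.
  case: b => /=.
    under eq_bigr do rewrite eqb_id.
    by rewrite sum_ord_ltn; congr _%:R; lia.
  transitivity (\sum_(j < n) (1 - (j < r)%N%:R) : R).
    by apply: eq_bigr => j _; case: (j < r)%N; rewrite ?subrr ?subr0.
  rewrite sumrB sum_ord_ltn sumr_const card_ord -natrB; last lia.
  by congr _%:R; lia.
apply: eigval_cubic.
- by rewrite ltr0n muln_gt0 r0.
- lia.
- have A2 i k : (adjacency R (complete_bipartite n r) *m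
      adjacency R (complete_bipartite n r)) i k =
      ((i < r)%N == (k < r)%N)%:R * (d (~~ (i < r)%N))%:R.
    rewrite mxE -sumd mulr_sumr; apply: eq_bigr => j _; rewrite !mxE /=.
    by rewrite -!natrM; congr _%:R; do 3!case: (_ < r)%N.
  apply/matrixP => i l; rewrite mxE.
  under eq_bigr => k _ do rewrite A2 !mxE.
  rewrite !mxE /= -(dd (i < r)%N) natrM -[in RHS]sumd mulr_suml mulr_suml.
  apply: eq_bigr => k _.
  by rewrite /d; do 3!case: (_ < r)%N; rewrite /=; ring.
under eq_bigr => i _.
  under eq_bigr => j _.
    rewrite /= (_ : _ != _ = ((j < r)%N == ~~ (i < r)%N)); last by do 2!case: (_ < r)%N.
    over.
  rewrite sumd; over.
transitivity (\sum_(i < n) (((i < r)%N == true)%:R * s%:R +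
                            ((i < r)%N == false)%:R * r%:R) : R).
  by apply: eq_bigr => i _; case: (i < r)%N; rewrite /= !(mul0r, mul1r, addr0, add0r).
by rewrite big_split /= -!mulr_suml !sumd /d natrM mulr2n; ring.
Qed.

(** The square of the adjacency matrix is the diagonal projection onto the
    matched vertices, which are those below [n./2.*2]. *)
Lemma eigval_matching (R : realType) n j : (j < n)%N ->
  eigval (matching n) j.+1 = level R n n./2 j.
Proof.
(* The partner of the last vertex is out of range when n is odd. *)
pose partner i := if odd i then i.-1 else i.+1.
have mE (i k : 'I_n) : matching n i k = (k == partner i :> nat).
  rewrite /= /partner -val_eqE /=.
  by move: (nat_of_ord i) (nat_of_ord k) => a b; case: ifP => oa; lia.
have lt_partner i : (i < n)%N -> (partner i < n)%N = (i < n./2.*2)%N.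
  by rewrite /partner; case: ifP; lia.
have sumA (i : 'I_n) (f : 'I_n -> R) : \sum_k (matching n i k)%:R * f k =
    if insub (partner i) is Some k then f k else 0.
  case: insubP => [k _ ek|]; last first.
    rewrite -leqNgt => ni; rewrite big1 // => k _; rewrite mE.
    by case: eqP => [kp|]; rewrite ?mul0r //; have := ltn_ord k; lia.
  rewrite (bigD1 k) // mE -ek eqxx mul1r big1 => [|l lk]; first exact: addr0.
  by rewrite mE -ek val_eqE (negPf lk) mul0r.
move=> jn; rewrite -[RHS]mul1r -sqrtr1; apply: eigval_cubic => //; first lia.
- have A2 : adjacency R (matching n) *m adjacency R (matching n) =
      diag_mx (\row_i (i < n./2.*2)%N%:R).
    apply/matrixP => i k; rewrite !mxE.
    under eq_bigr do rewrite !mxE; rewrite (sumA i (fun l => (matching n l k)%:R)).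
    case: insubP => [l pi el|].
      rewrite mE el -lt_partner // pi -val_eqE /= /partner eq_sym.
      by congr (nat_of_bool _)%:R; case: (boolP (odd i)) => oi; case: ifP; lia.
    by rewrite lt_partner // => /negPf ->; rewrite mul0rn.
  rewrite A2 scale1r mul_diag_mx; apply/matrixP => i k; rewrite !mxE mE.
  case: eqP => [e|]; last by rewrite mulr0.
  by rewrite -lt_partner // -e ltn_ord mulr1.
transitivity (\sum_(i < n) (i < n./2.*2)%N%:R : R).
  apply: eq_bigr => i _; have := sumA i (fun=> 1).
  under eq_bigr do rewrite mulr1.
  move=> ->; rewrite -lt_partner //; by case: insubP => [? ->|/negPf->].
by rewrite sum_ord_ltn; congr _%:R; lia.
Qed.

(** * Majorization and concavity of partial sums *)

Definition nonincreasing_below (R : numDomainType) n (x : nat -> R) :=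
  forall i j, (i <= j < n)%N -> x j <= x i.

Lemma rearrangement_id (R : realType) n (x : nat -> R) :
  nonincreasing_below n x -> rearrangement (\row_(j < n) x j) = \row_j x j.
Proof.
move=> dx; have ex : [seq (\row_(j < n) x j) 0 i | i <- enum 'I_n] = mkseq x n.
  rewrite /mkseq -val_enum_ord -map_comp; apply: eq_map => i.
  by rewrite mxE.
apply/rowP => j; rewrite !mxE ex sorted_sort ?nth_mkseq //.
  by move=> a b c; rewrite /= => ? /le_trans; apply.
apply/(sortedP 0) => i; rewrite size_mkseq => i_n.
by rewrite !nth_mkseq ?(ltnW i_n) //; apply: dx; rewrite leqnSn.
Qed.

Lemma majorized_prefix_sums (R : realType) n (x y : nat -> R) :
  nonincreasing_below n x -> nonincreasing_below n y ->
  (forall k, (0 < k < n)%N -> \sum_(j < k) x j <= \sum_(j < k) y j) ->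
  \sum_(j < n) x j = \sum_(j < n) y j ->
  majorized (\row_(j < n) x j) (\row_(j < n) y j).
Proof.
move=> dx dy le_xy eq_xy.
have sumE (z : nat -> R) k : (k <= n)%N ->
    \sum_(j < n | (j < k)%N) (\row_(j < n) z j) 0 j = \sum_(j < k) z j.
  move=> kn; rewrite (big_ord_widen_cond n xpredT z kn).
  by apply: eq_bigr => j _; rewrite mxE.
rewrite /majorized !rearrangement_id //; split; last first.
  by under eq_bigr do rewrite mxE; under [RHS]eq_bigr do rewrite mxE.
move=> k /andP[k0 kn]; rewrite !sumE //.
by move: kn; rewrite leq_eqVlt => /predU1P[->|kn]; [rewrite eq_xy | rewrite le_xy ?k0].
Qed.

Section PrefixSums.
Variables (R : realType) (n : nat) (x : nat -> R).
Hypothesis dx : nonincreasing_below n x.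
Let S k := \sum_(j < k) x j.

Lemma sum_tail k : (k <= n)%N -> S n = S k + \sum_(k <= j < n) x j.
Proof. by move=> kn; rewrite /S -!(big_mkord xpredT) -big_cat_nat. Qed.

Lemma prefix_increment_ge i j : (i < j <= n)%N -> S i + (j - i)%:R * x j.-1 <= S j.
Proof.
move=> /andP[ij jn]; rewrite /S -!(big_mkord xpredT).
rewrite (big_cat_nat (n := i) _ (ltnW ij)) //=.
rewrite lerD2l mulr_natl -sumr_const_nat [leLHS]big_nat [leRHS]big_nat.
by apply: ler_sum => h /andP[_ hj]; apply: dx; lia.
Qed.

Lemma prefix_increment_le i j : (i <= j <= n)%N -> S j <= S i + (j - i)%:R * x i.
Proof.
move=> /andP[ij jn]; rewrite /S -!(big_mkord xpredT) (big_cat_nat (n := i) _ ij) //=.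
rewrite lerD2l mulr_natl -sumr_const_nat [leLHS]big_nat [leRHS]big_nat.
by apply: ler_sum => h /andP[ih hj]; apply: dx; lia.
Qed.

(** Concavity of [S]: the slope from [i] to [j] is at least [x j.-1] and the
    slope from [j] to [k] at most [x j]. Multiplying out the chord inequality
    keeps the degenerate cases [i = j] and [j = k]. *)
Lemma prefix_concave i j k : (i <= j <= k)%N -> (k <= n)%N ->
  (k - j)%:R * S i + (j - i)%:R * S k <= (k - i)%:R * S j.
Proof.
move=> /andP[ij jk] kn.
have -> : (k - i)%:R = (k - j)%:R + (j - i)%:R :> R by rewrite -natrD; congr _%:R; lia.
move: ij; rewrite leq_eqVlt => /predU1P[->|ij]; first by rewrite subnn; lra.
have lo := @prefix_increment_ge i j; rewrite ij (leq_trans jk kn) in lo.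
have up := @prefix_increment_le j k; rewrite jk kn in up.
have {}lo := lo isT; have {}up := up isT.
move: jk; rewrite leq_eqVlt => /predU1P[->|jk]; first by rewrite subnn; lra.
have xx : x j <= x j.-1 by apply: dx; lia.
have a0 : 0 <= (k - j)%:R :> R by [].
have b0 : 0 <= (j - i)%:R :> R by [].
set a := (k - j)%:R in up a0 *; set b := (j - i)%:R in lo b0 *.
have : a * (S i + b * x j.-1) <= a * S j by apply: ler_wpM2l.
have : b * S k <= b * (S j + a * x j) by apply: ler_wpM2l.
have : (a * b) * x j <= (a * b) * x j.-1 by rewrite ler_wpM2l ?mulr_ge0.
lra.
Qed.

Hypothesis sum0 : S n = 0.

Let S0 : S 0 = 0. Proof. exact: big_ord0. Qed.

Lemma prefix_ge0 k : (k <= n)%N -> 0 <= S k.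
Proof.
case: n sum0 prefix_concave => [|n'] s0 conc kn.
  by rewrite (_ : k = 0%N) ?S0 //; lia.
have := conc 0 k n'.+1; rewrite kn leqnn s0 S0 !mulr0 addr0 => /(_ isT isT).
by rewrite pmulr_rge0 // ltr0n; lia.
Qed.

(** The tent [b * minn k (n - k)] is linear from 0 to [n./2] and from
    [n - n./2] to [n], so a concave sequence vanishing at both ends dominates it
    once it does so at the two middle indices. *)
Lemma prefix_ge_hat b k : (1 < n)%N ->
  b * n./2%:R <= S n./2 -> b * n./2%:R <= S (n - n./2) -> (k <= n)%N ->
  b * (minn k (n - k))%:R <= S k.
Proof.
move=> n1 bm bm' kn; have m0 : 0 < n./2%:R :> R by rewrite ltr0n; lia.
rewrite -(ler_pM2l m0); have [km|km] := leqP k n./2.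
  have := @prefix_concave 0 k n./2; rewrite S0 mulr0 add0r !subn0 km.
  move=> /(_ isT _) h; apply: le_trans (h _); last lia.
  rewrite (_ : minn _ _ = k); last lia.
  by have := ler_wpM2l (ler0n R k) bm; lra.
have := @prefix_concave (n - n./2) k n; rewrite sum0 mulr0 addr0 subKn ?leqnn; last lia.
move=> h; apply: le_trans (h _ isT); last lia.
rewrite (_ : minn _ _ = (n - k)%N); last lia.
by have := ler_wpM2l (ler0n R (n - k)) bm'; lra.
Qed.

Lemma prefix_le_head k : (k <= n)%N -> S k <= k%:R * x 0.
Proof.
by move=> kn; have := @prefix_increment_le 0 k; rewrite kn S0 add0r subn0 => ->.
Qed.

(** [S k] is minus the sum of the last [n - k] terms, each at least the last
    one. *)
Lemma prefix_le_last k : (k <= n)%N -> S k <= (n - k)%:R * - x n.-1.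
Proof.
rewrite leq_eqVlt => /predU1P[->|kn]; first by rewrite sum0 subnn mul0r.
have := @prefix_increment_ge k n; rewrite kn leqnn sum0 => /(_ isT); lra.
Qed.

Lemma last_le0 : (0 < n)%N -> x n.-1 <= 0.
Proof.
move=> n0; have := prefix_le_last (leq0n n).
by rewrite S0 mulrN oppr_ge0 subn0 pmulr_rle0 ?ltr0n.
Qed.

(** The chord of the concave sequence [S] from 1 to [n], where it vanishes. *)
Lemma prefix_ge_complete k : (0 < k <= n)%N -> x 0 * (n - k)%:R <= (n - 1)%:R * S k.
Proof.
move=> kn; have := @prefix_concave 1 k n; rewrite kn leqnn sum0 mulr0 addr0.
by rewrite {1}/S big_ord_recl big_ord0 addr0 mulrC => ->.
Qed.

(** By concavity [S] is smallest at an end of the range from 1 to [n.-1], and its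
    values there are [x 0] and [- x n.-1]. *)
Lemma prefix_ge_last k : - x n.-1 <= x 0 -> (0 < k < n)%N -> - x n.-1 <= S k.
Proof.
move=> le_last /andP[k0 kn].
have Sn1 : S n.-1 = - x n.-1.
  have := sum_tail (leq_pred n); rewrite sum0 big_ltn ?big_geq ?leqSpred //; [lra | lia].
(* This separates n = 2, where the chord from 1 to n.-1 degenerates. *)
have [kn1|] := eqVneq k n.-1; first by rewrite kn1 Sn1.
move=> kn1; have := @prefix_concave 1 k n.-1.
rewrite Sn1 {1}/S big_ord_recl big_ord0 addr0 => /(_ _ _) h.
have d0 : 0 < (n.-1 - 1)%:R :> R by rewrite ltr0n; lia.
rewrite -(ler_pM2l d0); apply: le_trans (h _ _); try lia.
have -> : (n.-1 - 1)%:R = (n.-1 - k)%:R + (k - 1)%:R :> R.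
  by rewrite -natrD; congr _%:R; lia.
by rewrite mulrDl lerD2r ler_wpM2l.
Qed.

(** [S k] equals minus the sum of the remaining terms, so twice [S k] is a signed
    sum of all the terms. *)
Lemma prefix_le_half_norm k : (k <= n)%N -> 2 * S k <= \sum_(j < n) `|x j|.
Proof.
move=> kn; have := sum_tail kn; rewrite sum0 => tail.
rewrite -(big_mkord xpredT (fun j => `|x j|)) (big_cat_nat (n := k)) //=.
have : S k <= \sum_(0 <= j < k) `|x j|.
  by rewrite /S -(big_mkord xpredT); apply: ler_sum => j _; apply: ler_norm.
have : - \sum_(k <= j < n) x j <= \sum_(k <= j < n) `|x j|.
  by rewrite -sumrN; apply: ler_sum => j _; rewrite -normrN ler_norm.
lra.
Qed.

Hypothesis sym : forall j, (j < n)%N -> x (n.-1 - j) = - x j.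

Lemma symmetric_prefix k : (k <= n)%N -> S (n - k) = S k.
Proof.
move=> kn; have := sum_tail (leq_subr k n); rewrite sum0.
suff -> : \sum_(n - k <= j < n) x j = - S k by lra.
rewrite -[X in \sum_(X <= _ < _) _]add0n big_addn subKn // big_nat_rev big_mkord.
rewrite /S -sumrN; apply: eq_bigr => j _; rewrite -sym; last by have := ltn_ord j; lia.
by congr x; have := ltn_ord j; lia.
Qed.

Lemma symmetric_half_norm : \sum_(j < n) `|x j| = 2 * S n./2.
Proof.
have ge0 j : (j < n./2)%N -> 0 <= x j.
  move=> jm; have : x (n.-1 - j) <= x j by apply: dx; lia.
  by rewrite sym; [lra | lia].
have le0 j : (n./2 <= j < n)%N -> x j <= 0.
  move=> jm; have : x j <= x (n.-1 - j) by apply: dx; lia.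
  by rewrite sym; [lra | lia].
have nm : (n./2 <= n)%N by lia.
have := sum_tail nm; rewrite sum0 => tail; rewrite -(big_mkord xpredT (fun j => `|x j|)).
rewrite (big_cat_nat (n := n./2)) //=.
have -> : \sum_(0 <= j < n./2) `|x j| = S n./2.
  by rewrite /S big_mkord; apply: eq_bigr => j _; rewrite ger0_norm ?ge0.
have -> : \sum_(n./2 <= j < n) `|x j| = - \sum_(n./2 <= j < n) x j.
  rewrite -sumrN big_nat [RHS]big_nat.
  by apply: eq_bigr => j /le0; apply: ler0_norm.
lra.
Qed.

End PrefixSums.

(** * Partial sums of graph spectra *)

Lemma sum_eigval0 (R : realType) n (G : sgraph n) : \sum_(j < n) eigval G j.+1 = 0 :> R.
Proof. by rewrite (sum_eigval G id) sum_eigenvalues. Qed.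

(** Comparing the partial sums of two spectra suffices, since all spectra have
    the same total sum, zero. *)
Lemma schur_convex_spectra_le (R : realType) n (F : 'rV[R]_n -> R)
    (G H : sgraph n) (a b : R) :
  schur_convex F -> positively_homogeneous F -> 0 <= a -> 0 <= b ->
  (forall k, (0 < k < n)%N ->
     a * \sum_(j < k) eigval G j.+1 <= b * \sum_(j < k) eigval H j.+1) ->
  a * F (spectrum G) <= b * F (spectrum H).
Proof.
move=> convF homF a0 b0 le_ab; rewrite -!homF //.
have scaleE (c : R) (K : sgraph n) : c *: spectrum K = \row_(j < n) (c * eigval K j.+1).
  by apply/rowP => j; rewrite !mxE.
have dec (c : R) (K : sgraph n) : 0 <= c ->
    nonincreasing_below n (fun j => c * eigval K j.+1).
  by move=> c0 i j ij; rewrite ler_wpM2l ?eigval_nonincreasing.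
apply: convF; rewrite !scaleE.
apply: (@majorized_prefix_sums _ _ (fun j => a * eigval G j.+1)
                                   (fun j => b * eigval H j.+1)); try exact: dec.
  by move=> k /le_ab; rewrite !mulr_sumr.
by rewrite -!mulr_sumr !sum_eigval0 !mulr0.
Qed.

Lemma sum_level (R : pzRingType) n m k : (m.*2 <= n)%N -> (k <= n)%N ->
  \sum_(j < k) level R n m j = (minn (minn k m) (n - k))%:R.
Proof.
move=> mn kn; rewrite sumrB sum_ord_ltn.
have -> : \sum_(j < k) (n - m <= j)%:R = (k - (n - m))%:R :> R.
  elim: k {kn} => [|k IHk]; first by rewrite big_ord0 sub0n.
  by rewrite big_ord_recr /= IHk -natrD; congr _%:R; lia.
by rewrite -natrB; [congr _%:R | ]; lia.
Qed.

Section SpecialGraphs.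
Variables (R : realType) (n : nat).
Implicit Types (G : sgraph n) (k : nat).

Lemma sum_eigval_matching k : (k <= n)%N ->
  \sum_(j < k) eigval (matching n) j.+1 = (minn k (n - k))%:R :> R.
Proof.
move=> kn; transitivity (\sum_(j < k) level R n n./2 j).
  by apply: eq_bigr => j _; rewrite eigval_matching // (leq_trans (ltn_ord j)).
by rewrite sum_level //; [congr _%:R|]; lia.
Qed.

Lemma sum_eigval_complete k : (1 < n)%N -> (0 < k <= n)%N ->
  \sum_(j < k) eigval (complete n) j.+1 = (n - k)%:R :> R.
Proof.
case: k => // k n1 /= kn; rewrite big_ord_recl eigval_complete //=; last lia.
rewrite (eq_bigr (fun=> - 1)); last first.
  by move=> j _; rewrite /bump /= add1n eigval_complete //=; have := ltn_ord j; lia.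
rewrite sumr_const card_ord mulNrn -natrB; last lia.
by congr _%:R; lia.
Qed.

Lemma sum_eigval_complete_bipartite r s k :
  (0 < r)%N -> (0 < s)%N -> (r + s)%N = n -> (0 < k < n)%N ->
  \sum_(j < k) eigval (complete_bipartite n r) j.+1 = Num.sqrt (r * s)%:R :> R.
Proof.
move=> r0 s0 rsn /andP[k0 kn].
transitivity (\sum_(j < k) Num.sqrt (r * s)%:R * level R n 1 j).
  apply: eq_bigr => j _; apply: eigval_complete_bipartite => //.
  by rewrite (leq_trans (ltn_ord j)) // ltnW.
rewrite -mulr_sumr sum_level //; [|lia|lia].
by rewrite (_ : minn _ _ = 1%N) ?mulr1 //; lia.
Qed.

Lemma energy_sum G : energy G = \sum_(j < n) `|eigval G j.+1| :> R.
Proof. by rewrite /energy big_add1 big_mkord. Qed.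

(** Both parities of [beta] are the same quantity: up to the factor
    [floor (n / 2)], it is the smaller of the two partial sums around the
    middle of the spectrum. *)
Lemma beta_half G : (1 < n)%N ->
  beta G * n./2%:R = Num.min (\sum_(j < n./2) eigval G j.+1)
                             (\sum_(j < n - n./2) eigval G j.+1) :> R.
Proof.
move=> n1; have m0 : n./2%:R != 0 :> R by rewrite pnatr_eq0; lia.
have sumE k : \sum_(1 <= j < k.+1) eigval G j = \sum_(j < k) eigval G j.+1 :> R.
  by rewrite big_add1 big_mkord.
rewrite /beta !sumE; case: ifPn => on.
  have -> : n.-1%:R = 2 * n./2%:R :> R by rewrite -natrM; congr _%:R; lia.
  have -> : (n.-1)./2 = n./2 by lia.
  have -> : (n.+1)./2 = n./2.+1 by lia.
  have -> : (n - n./2)%N = n./2.+1 by lia.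
  rewrite big_ord_recr /=.
  set S := \sum_(_ < _) _; set e := eigval _ _.
  have -> : Num.min S (S + e) = S + Num.min 0 e by rewrite addr_minr addr0.
  by field.
have -> : n%:R = 2 * n./2%:R :> R by rewrite -natrM; congr _%:R; lia.
have -> : (n - n./2)%N = n./2 by lia.
by rewrite minxx; field.
Qed.

Lemma bipartite_spectrum_symmetric G j : bipartite G -> (j < n)%N ->
  eigval G (n.-1 - j).+1 = - eigval G j.+1 :> R.
Proof.
move=> bipG jn; have ge_tr : transitive (>=%R : rel R).
  by move=> a b c; rewrite /= => ? /le_trans; apply.
set s := eigenvalues (adjacency R G).
have eqs : rev [seq - x | x <- s] = s.
  apply: (sorted_eq ge_tr) => //.
  - by move=> a b; rewrite /= andbC => /le_anti.
  - rewrite rev_sorted sorted_map.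
    by apply: sub_sorted (eigenvalues_sorted _) => a b /=; rewrite lerN2.
  - exact: eigenvalues_sorted.
  - apply: perm_trans (bipartite_eigenvalues R bipG).
    by apply/permEl; apply: perm_rev.
have sz : size s = n := size_eigenvalues R G.
rewrite /eigval /= -/s -{1}eqs nth_rev ?size_map sz; last lia.
by rewrite (nth_map 0) ?sz; [congr (- nth _ _ _)|]; lia.
Qed.

End SpecialGraphs.

(** * Comparison of a graph with the three extremal graphs *)

Section EnergyLikeBounds.
Variables (R : realType) (n : nat) (F : 'rV[R]_n -> R).
Hypotheses (n1 : (1 < n)%N) (convF : schur_convex F).
Hypothesis homF : positively_homogeneous F.
Variable G : sgraph n.
Let phi (H : sgraph n) := F (spectrum H).
Let lam j : R := eigval G j.+1.

Let dlam : nonincreasing_below n lam.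
Proof. by move=> i j ij; apply: eigval_nonincreasing. Qed.

Let lam0 : \sum_(j < n) lam j = 0.
Proof. exact: sum_eigval0. Qed.

Let lam_last : lam n.-1 = eigval G n.
Proof. by rewrite /lam prednK //; lia. Qed.

Lemma eigval_last_norm : `|eigval G n| = - eigval G n :> R.
Proof. by rewrite ler0_norm // -lam_last; apply: last_le0 => //; lia. Qed.

Lemma eigval_last_norm_le : `|eigval G n| <= eigval G 1 :> R.
Proof. by rewrite eigval_last_norm eigval_last_ge //; lia. Qed.

Lemma eigval1_ge0 : 0 <= eigval G 1 :> R.
Proof. exact: le_trans (normr_ge0 _) eigval_last_norm_le. Qed.

Lemma phi_ge0 : 0 <= phi G.
Proof.
rewrite -[phi G]mul1r -[leLHS](mul0r (phi G)).
apply: schur_convex_spectra_le => // k kn; rewrite mul0r mul1r.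
by apply: (prefix_ge0 dlam lam0); lia.
Qed.

(** Homogeneity only covers nonnegative multiples; for negative [b] the bound
    follows from [phi_ge0]. *)
Lemma phi_ge_matching b :
  b * n./2%:R <= \sum_(j < n./2) lam j ->
  b * n./2%:R <= \sum_(j < n - n./2) lam j -> 0 < phi (matching n) ->
  b * phi (matching n) <= phi G.
Proof.
move=> bm bm' M0; have [b0|b0] := leP 0 b; last first.
  by apply: le_trans phi_ge0; rewrite nmulr_rle0 // ltW.
rewrite -[leRHS]mul1r; apply: schur_convex_spectra_le => // k kn.
rewrite mul1r sum_eigval_matching; last lia.
by apply: (prefix_ge_hat dlam) => //; lia.
Qed.

Lemma phi_le_matching : phi G <= eigval G 1 * phi (matching n).
Proof.
rewrite -[leLHS]mul1r; apply: schur_convex_spectra_le => //; first exact: eigval1_ge0.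
move=> k kn; rewrite mul1r sum_eigval_matching; last lia.
have [kk|kk] := leqP k (n - k).
  by rewrite mulrC; apply: (prefix_le_head dlam); lia.
apply: le_trans (prefix_le_last dlam lam0 _) _; first lia.
by rewrite lam_last mulrC ler_wpM2r // -eigval_last_norm eigval_last_norm_le.
Qed.

Lemma phi_ge_complete : eigval G 1 * phi (complete n) <= (n - 1)%:R * phi G.
Proof.
apply: schur_convex_spectra_le => //; first exact: eigval1_ge0.
move=> k kn; rewrite sum_eigval_complete //; last lia.
by apply: (prefix_ge_complete dlam) => //; lia.
Qed.

Lemma phi_le_complete : phi G <= `|eigval G n| * phi (complete n).
Proof.
rewrite -[leLHS]mul1r; apply: schur_convex_spectra_le => // k kn.
rewrite mul1r sum_eigval_complete //; last lia.
rewrite eigval_last_norm -lam_last mulrC.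
by apply: (prefix_le_last dlam) => //; lia.
Qed.

Variables r s : nat.
Hypotheses (r0 : (0 < r)%N) (s0 : (0 < s)%N) (rsn : (r + s)%N = n).

Lemma phi_ge_complete_bipartite :
  `|eigval G n| * phi (complete_bipartite n r) <= Num.sqrt (r * s)%:R * phi G.
Proof.
apply: schur_convex_spectra_le; rewrite ?sqrtr_ge0 // => k kn.
rewrite (sum_eigval_complete_bipartite R r0 s0 rsn kn) mulrC ler_wpM2l ?sqrtr_ge0 //.
rewrite eigval_last_norm -lam_last; apply: (prefix_ge_last dlam) => //.
by rewrite lam_last -eigval_last_norm eigval_last_norm_le.
Qed.

Lemma phi_le_complete_bipartite :
  Num.sqrt (r * s)%:R * phi G <= energy G / 2 * phi (complete_bipartite n r).
Proof.
apply: schur_convex_spectra_le; rewrite ?sqrtr_ge0 //.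
  by rewrite divr_ge0 // sumr_ge0.
move=> k kn; rewrite (sum_eigval_complete_bipartite R r0 s0 rsn kn) mulrC.
rewrite ler_wpM2r ?sqrtr_ge0 // energy_sum.
have := prefix_le_half_norm lam0 (k := k); rewrite /lam => /(_ _).
move=> h; rewrite ler_pdivlMr // mulrC; apply: h; lia.
Qed.

End EnergyLikeBounds.

Lemma matching_has_edge n : (1 < n)%N -> has_edge (matching n).
Proof.
by case: n => [|[|n]] // _; exists (inord 0), (inord 1); rewrite /= -val_eqE /= !inordK.
Qed.

Lemma complete_has_edge n : (1 < n)%N -> has_edge (complete n).
Proof. by case: n => [|[|n]] // _; exists ord0, ord_max. Qed.

Lemma complete_bipartite_has_edge n r :
  (0 < r < n)%N -> has_edge (complete_bipartite n r).
Proof.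
move=> rn; have n0 : (0 < n)%N by lia.
exists (Ordinal n0), (Ordinal (proj2 (andP rn))).
by rewrite /= ltnn; case/andP: rn => ->.
Qed.

Lemma complete_bipartite_bipartite n r : bipartite (complete_bipartite n r).
Proof. by exists [set i : 'I_n | (i < r)%N] => i j; rewrite !inE. Qed.

Theorem theorem2p5 (R : realType) (n : nat) (F : 'rV[R]_n -> R) :
  let phi (H : sgraph n) : R := F (spectrum H) in
  (2 <= n)%N ->
  schur_convex F ->
  positively_homogeneous F ->
  (forall H : sgraph n, has_edge H -> 0 < phi H) ->
  [/\ forall (G : sgraph n) (r s : nat),
        (0 < r)%N -> (0 < s)%N -> (r + s)%N = n ->
        [/\ beta G / (n - 1)%:R <= phi G / ((n - 1)%:R * phi (matching n)),
            phi G / ((n - 1)%:R * phi (matching n)) <= eigval G 1 / (n - 1)%:R,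
            eigval G 1 / (n - 1)%:R <= phi G / phi (complete n),
            phi G / phi (complete n) <= `|eigval G n|
          & `|eigval G n| <= Num.sqrt (r * s)%:R * phi G
                               / phi (complete_bipartite n r)
            /\ Num.sqrt (r * s)%:R * phi G / phi (complete_bipartite n r)
                 <= energy G / 2],
      forall (G : sgraph n) (r s : nat),
        (0 < r)%N -> (0 < s)%N -> (r + s)%N = n -> bipartite G ->
        [/\ energy G / (2 * (n./2)%:R) <= phi G / phi (matching n),
            phi G / phi (matching n) <= eigval G 1,
            eigval G 1 <= Num.sqrt (r * s)%:R * phi G
                            / phi (complete_bipartite n r)
          & Num.sqrt (r * s)%:R * phi G / phi (complete_bipartite n r)
              <= energy G / 2],
      (let G := matching n in
       beta G / (n - 1)%:R = phi G / ((n - 1)%:R * phi (matching n)) /\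
       phi G / ((n - 1)%:R * phi (matching n)) = eigval G 1 / (n - 1)%:R),
      (let G := complete n in
       eigval G 1 / (n - 1)%:R = phi G / phi (complete n) /\
       phi G / phi (complete n) = `|eigval G n|)
    & forall r s : nat, (0 < r)%N -> (0 < s)%N -> (r + s)%N = n ->
      let G := complete_bipartite n r in
       `|eigval G n| = Num.sqrt (r * s)%:R * phi G
                         / phi (complete_bipartite n r) /\
       Num.sqrt (r * s)%:R * phi G / phi (complete_bipartite n r)
         = energy G / 2].
Proof.
move=> phi n1 convF homF pos.
have M0 : 0 < phi (matching n) by apply/pos/matching_has_edge.
have K0 : 0 < phi (complete n) by apply/pos/complete_has_edge.
have B0 r s : (0 < r)%N -> (0 < s)%N -> (r + s)%N = n ->
    0 < phi (complete_bipartite n r).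
  by move=> r0 s0 rsn; apply/pos/complete_bipartite_has_edge; lia.
have N0 : 0 < (n - 1)%:R :> R by rewrite ltr0n; lia.
have m0 : 0 < n./2%:R :> R by rewrite ltr0n; lia.
have divM y : y / ((n - 1)%:R * phi (matching n)) = y / phi (matching n) / (n - 1)%:R.
  by rewrite [_ * phi _]mulrC invfM mulrA.
have chain G : [/\ beta G <= phi G / phi (matching n),
    phi G / phi (matching n) <= eigval G 1,
    eigval G 1 / (n - 1)%:R <= phi G / phi (complete n)
    & phi G / phi (complete n) <= `|eigval G n|].
  have mid := beta_half R G n1.
  split.
  - rewrite ler_pdivlMr //; apply: phi_ge_matching => //.
      by rewrite mid ge_min lexx.
    by rewrite mid ge_min lexx orbT.
  - by rewrite ler_pdivrMr //; apply: phi_le_matching.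
  - rewrite ler_pdivrMr // mulrAC ler_pdivlMr // [leRHS]mulrC.
    exact: phi_ge_complete.
  - by rewrite ler_pdivrMr //; apply: phi_le_complete.
have chainB G r s : (0 < r)%N -> (0 < s)%N -> (r + s)%N = n ->
    `|eigval G n| <= Num.sqrt (r * s)%:R * phi G / phi (complete_bipartite n r) /\
    Num.sqrt (r * s)%:R * phi G / phi (complete_bipartite n r) <= energy G / 2.
  move=> r0 s0 rsn; rewrite ler_pdivlMr ?ler_pdivrMr ?(B0 r s) //.
  split; first exact: phi_ge_complete_bipartite.
  exact: phi_le_complete_bipartite.
split.
- move=> G r s r0 s0 rsn; rewrite divM !ler_pM2r ?invr_gt0 //.
  by case: (chain G) => *; split=> //; apply: chainB.
- move=> G r s r0 s0 rsn bipG.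
  have sym := bipartite_spectrum_symmetric R bipG.
  have [_ le1 _ _] := chain G; have [] := chainB G r s r0 s0 rsn.
  have -> : `|eigval G n| = eigval G 1 :> R.
    have := sym 0%N; rewrite subn0 prednK; last lia.
    by move=> e; rewrite eigval_last_norm // e ?opprK //; lia.
  move=> le2 le3; split=> //; rewrite ler_pdivlMr //.
  have dlam : nonincreasing_below n (fun j => eigval G j.+1 : R).
    by move=> i j; apply: eigval_nonincreasing.
  have lam0 := sum_eigval0 R G.
  have half : energy G / (2 * n./2%:R) * n./2%:R = \sum_(j < n./2) eigval G j.+1 :> R.
    rewrite energy_sum (symmetric_half_norm dlam lam0 sym).
    by field; rewrite lt0r_neq0.
  apply: phi_ge_matching => //; rewrite half //.
  by rewrite (symmetric_prefix lam0 sym) //; lia.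
- have e1 : eigval (matching n) 1 = 1 :> R.
    rewrite eigval_matching ?(ltnW n1) // /level.
    have -> : (0 < n./2)%N by lia.
    have -> : (n - n./2 <= 0)%N = false by lia.
    by rewrite subr0.
  have eb : beta (matching n) = 1 :> R.
    apply: (mulIf (lt0r_neq0 m0)); rewrite beta_half // !sum_eigval_matching; [|lia|lia].
    rewrite mul1r (_ : minn n./2 _ = n./2); last lia.
    by rewrite (_ : minn _ _ = n./2) ?minxx //; lia.
  by rewrite /= divM e1 eb divff ?lt0r_neq0.
- have e1 : eigval (complete n) 1 = (n - 1)%:R :> R.
    by rewrite eigval_complete // ltnW.
  have en : eigval (complete n) n = - 1 :> R.
    have := eigval_complete R n1 (j := n.-1); rewrite prednK ?(ltnW n1) //.
    by move=> ->; rewrite ?ifF //; lia.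
  by rewrite /= e1 en !divff ?lt0r_neq0 // normrN1.
move=> r s r0 s0 rsn G; have G0 : 0 < phi G by apply: B0 rsn.
have en : `|eigval G n| = Num.sqrt (r * s)%:R :> R.
  rewrite eigval_last_norm //.
  have := eigval_complete_bipartite R r0 s0 rsn (j := n.-1).
  rewrite prednK ?(ltnW n1) // => -> //.
  rewrite /level (_ : (n.-1 < 1)%N = false); last lia.
  by rewrite subn1 leqnn sub0r mulrN1 opprK.
rewrite mulfK ?lt0r_neq0 // en; split=> //.
have sym := bipartite_spectrum_symmetric R (complete_bipartite_bipartite n r).
rewrite energy_sum (symmetric_half_norm _ (sum_eigval0 R G) sym); last first.
  by move=> i j; apply: eigval_nonincreasing.
rewrite (sum_eigval_complete_bipartite R r0 s0 rsn); last lia.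
by field.
Qed.
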